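(* Let $H$ be a complex vector space with a countable (Hamel) basis $(e_n)_{n\in\mathbb N}$. Then for every linear functional $\Phi\colon H\otimes H\to\mathbb C$ on the algebraic tensor product $H\otimes H$, there exists an inner product on $H$ such that $\Phi$ is bounded (with respect to the induced pre-Hilbert space inner product on $H\otimes H$, determined by $\langle x\otimes y,x'\otimes y'\rangle=\langle x,x'\rangle\langle y,y'\rangle$). *)

(* Defs.v *)
From HB Require Import structures.
From mathcomp Require Import all_boot all_order all_algebra.
From mathcomp Require Import generic_quotient.
From mathcomp Require Import complex.
From mathcomp Require Import boolp reals.

Set Implicit Arguments.
Unset Strict Implicit.
Unset Printing Implicit Defensive.

Import Order.TTheory GRing.Theory Num.Theory.

Local Open Scope ring_scope.
Local Open Scope quotient_scope.

(* Sums over initial segments suffice: any finite linear combination of the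
   [e i] extends to one over some {0, ..., n-1} by zero coefficients. *)
Definition hamel_basis (K : fieldType) (V : lmodType K) (e : nat -> V) : Prop :=
  (forall (n : nat) (c : nat -> K),
     \sum_(i < n) c i *: e i = 0 -> forall i : 'I_n, c i = 0) /\
  (forall x : V, exists (n : nat) (c : nat -> K), x = \sum_(i < n) c i *: e i).

(* The universal property characterizing the algebraic tensor product
   (U1 (x) U2, (x)) up to unique isomorphism; see [tensor_product_exists]. *)
Definition is_tensor_product (K : fieldType) (U1 U2 T : lmodType K)
    (tau : {bilinear U1 -> U2 -> T}) : Prop :=
  forall (V : lmodType K) (f : {bilinear U1 -> U2 -> V}),
    (exists g : {linear T -> V}, forall x y, g (tau x y) = f x y) /\
    (forall g h : {linear T -> V},
       (forall x y, g (tau x y) = h (tau x y)) -> g =1 h).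

(* Unique when [tau] is a tensor product; see [tensor_dot_unique]. *)
Definition is_tensor_dot (C : numClosedFieldType) (H T : lmodType C)
    (tau : {bilinear H -> H -> T}) (ip : {dot H for Num.conj})
    (ipT : {dot T for Num.conj}) : Prop :=
  forall x y x' y' : H, ipT (tau x y) (tau x' y') = ip x x' * ip y y'.

Definition bounded_functional (R : realType) (T : lmodType R[i])
    (ipT : {dot T for Num.conj}) (Phi : {scalar T}) : Prop :=
  exists M : R, forall t : T, `|Phi t| <= M%:C%C * sqrtC (ipT t t).

Section TensorProductExists.
Variables (K : fieldType) (U1 U2 : lmodType K).

(* A list of triples (a, x, y) stands for the sum of the a (x (x) y). *)
Let word := seq (K * U1 * U2).

Let ev (V : lmodType K) (f : {bilinear U1 -> U2 -> V}) (s : word) : V :=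
  \sum_(p <- s) p.1.1 *: f p.1.2 p.2.

Definition tensor_rel (s t : word) : bool :=
  `[< forall (V : lmodType K) (f : {bilinear U1 -> U2 -> V}), ev f s = ev f t >].

Lemma tensor_rel_equiv : equiv_class_of tensor_rel.
Proof.
split=> [s|s t|t s u].
- exact/asboolP.
- by apply/asboolP/asboolP => h V f; rewrite h.
- by move=> /asboolP h1 /asboolP h2; apply/asboolP => V f; rewrite h1.
Qed.

Canonical tensor_equiv := EquivRelPack tensor_rel_equiv.

Definition tensor := {eq_quot tensor_equiv}.
HB.instance Definition _ := Choice.on tensor.
HB.instance Definition _ := EqQuotient.on tensor.

Let tev (V : lmodType K) (f : {bilinear U1 -> U2 -> V}) (t : tensor) : V :=
  ev f (repr t).

Let tev_pi (V : lmodType K) (f : {bilinear U1 -> U2 -> V}) s : tev f (\pi_tensor s) = ev f s.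
Proof.
have /eqmodP/asboolP : \pi_tensor (repr (\pi_tensor s)) = \pi_tensor s.
  by rewrite reprK.
exact.
Qed.

Let tensor_ext (t u : tensor) :
  (forall (V : lmodType K) (f : {bilinear U1 -> U2 -> V}), tev f t = tev f u) ->
  t = u.
Proof. by move=> h; rewrite -[t]reprK -[u]reprK; apply/eqmodP/asboolP. Qed.

Let scalew (a : K) (s : word) : word := [seq (a * p.1.1, p.1.2, p.2) | p <- s].

Let ev_scale (V : lmodType K) (f : {bilinear U1 -> U2 -> V}) a s : ev f (scalew a s) = a *: ev f s.
Proof.
by rewrite /ev big_map scaler_sumr; apply: eq_bigr => p _; rewrite scalerA.
Qed.

Definition tensor_add (t u : tensor) : tensor := \pi_tensor (repr t ++ repr u).
Definition tensor_scale (a : K) (t : tensor) : tensor :=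
  \pi_tensor (scalew a (repr t)).
Definition tensor_opp (t : tensor) : tensor := tensor_scale (-1) t.
Definition tensor_zero : tensor := \pi_tensor [::].

Let tev0 (V : lmodType K) (f : {bilinear U1 -> U2 -> V}) : tev f tensor_zero = 0.
Proof. by rewrite tev_pi /ev big_nil. Qed.

Let tevD (V : lmodType K) (f : {bilinear U1 -> U2 -> V}) t u :
  tev f (tensor_add t u) = tev f t + tev f u.
Proof. by rewrite tev_pi /ev big_cat. Qed.

Let tevZ (V : lmodType K) (f : {bilinear U1 -> U2 -> V}) a t :
  tev f (tensor_scale a t) = a *: tev f t.
Proof. by rewrite tev_pi ev_scale. Qed.

Let tevN (V : lmodType K) (f : {bilinear U1 -> U2 -> V}) t :
  tev f (tensor_opp t) = - tev f t.
Proof. by rewrite tevZ scaleN1r. Qed.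

Lemma tensor_addA : associative tensor_add.
Proof. by move=> t u v; apply: tensor_ext => V f; rewrite !tevD addrA. Qed.
Lemma tensor_addC : commutative tensor_add.
Proof. by move=> t u; apply: tensor_ext => V f; rewrite !tevD addrC. Qed.
Lemma tensor_add0 : left_id tensor_zero tensor_add.
Proof. by move=> t; apply: tensor_ext => V f; rewrite tevD tev0 add0r. Qed.
Lemma tensor_addN : left_inverse tensor_zero tensor_opp tensor_add.
Proof. by move=> t; apply: tensor_ext => V f; rewrite tevD tevN tev0 addNr. Qed.

HB.instance Definition _ :=
  GRing.isZmodule.Build tensor tensor_addA tensor_addC tensor_add0 tensor_addN.

Lemma tensor_scaleA a b t :
  tensor_scale a (tensor_scale b t) = tensor_scale (a * b) t.
Proof. by apply: tensor_ext => V f; rewrite !tevZ scalerA. Qed.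
Lemma tensor_scale1 : left_id 1 tensor_scale.
Proof. by move=> t; apply: tensor_ext => V f; rewrite tevZ scale1r. Qed.
Lemma tensor_scaleDr : right_distributive tensor_scale +%R.
Proof.
by move=> a t u; apply: tensor_ext => V f; rewrite [RHS]tevD !tevZ tevD scalerDr.
Qed.
Lemma tensor_scaleDl t : {morph tensor_scale^~ t : a b / a + b}.
Proof.
by move=> a b; apply: tensor_ext => V f; rewrite [RHS]tevD !tevZ scalerDl.
Qed.

HB.instance Definition _ := GRing.Zmodule_isLmodule.Build K tensor
  tensor_scaleA tensor_scale1 tensor_scaleDr tensor_scaleDl.

Definition pure_tensor (x : U1) (y : U2) : tensor := \pi_tensor [:: (1, x, y)].

Let tev_pure (V : lmodType K) (f : {bilinear U1 -> U2 -> V}) x y : tev f (pure_tensor x y) = f x y.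
Proof. by rewrite tev_pi /ev big_seq1 scale1r. Qed.

Lemma pure_tensor_bilinear :
  bilinear_for (GRing.Scale.Law.clone _ _ *:%R _) (GRing.Scale.Law.clone _ _ *:%R _)
    pure_tensor.
Proof.
split=> [y|x] a u v; apply: tensor_ext => V f.
- by rewrite [RHS]tevD tevZ !tev_pure linearPl.
- by rewrite [RHS]tevD tevZ !tev_pure linearPr.
Qed.

HB.instance Definition _ :=
  bilinear_isBilinear.Build K U1 U2 tensor _ _ pure_tensor pure_tensor_bilinear.

Lemma tensor_product_exists :
  exists (T : lmodType K) (tau : {bilinear U1 -> U2 -> T}), is_tensor_product tau.
Proof.
exists tensor, pure_tensor => V f; split.
  have lin : linear (tev f) by move=> a t u; rewrite tevD tevZ.
  pose L := GRing.isLinear.Build K tensor V *:%R (tev f) lin.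
  pose g : {linear tensor -> V} := HB.pack (tev f) L.
  by exists g => x y; rewrite /= tev_pure.
move=> g h gh t.
suff gE (k : {linear tensor -> V}) : k t =
    \sum_(p <- repr t) p.1.1 *: k (pure_tensor p.1.2 p.2).
  by rewrite !gE; apply: eq_bigr => p _; rewrite gh.
have {1}-> : t = \sum_(p <- repr t) p.1.1 *: pure_tensor p.1.2 p.2.
  apply: tensor_ext => W F; rewrite -{1}[t]reprK tev_pi /ev.
  elim: (repr t) => [|p s IHs]; first by rewrite !big_nil [RHS]tev0.
  by rewrite !big_cons [RHS]tevD tevZ tev_pure IHs.
by rewrite linear_sum; apply: eq_bigr => p _; rewrite linearZ.
Qed.

End TensorProductExists.

Lemma tensor_dot_unique (C : numClosedFieldType) (H T : lmodType C)
    (tau : {bilinear H -> H -> T}) (ip : {dot H for Num.conj})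
    (d1 d2 : {dot T for Num.conj}) :
  is_tensor_product tau -> is_tensor_dot tau ip d1 -> is_tensor_dot tau ip d2 ->
  forall t u, d1 t u = d2 t u.
Proof.
move=> tauP d1P d2P.
have lin (d : {dot T for Num.conj}) u : linear (fun t => d t u : C^o).
  by move=> a t t'; rewrite linearPl.
pose L (d : {dot T for Num.conj}) (u : T) : {linear T -> C^o} :=
  HB.pack (fun t : T => d t u : C^o) (GRing.isLinear.Build C T C^o *:%R _ (lin d u)).
have uniq (g h : {linear T -> C^o}) :
    (forall x y, g (tau x y) = h (tau x y)) -> g =1 h.
  have zbil : bilinear_for (GRing.Scale.Law.clone _ _ *:%R _)
      (GRing.Scale.Law.clone _ _ *:%R _) (fun _ _ : H => 0 : C^o).
    by split=> ? a ? ? /=; rewrite addr0 [RHS]mulr0.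
  pose z : {bilinear H -> H -> C^o} := HB.pack (fun _ _ : H => 0 : C^o)
    (bilinear_isBilinear.Build C H H C^o _ _ _ zbil).
  exact: (tauP _ z).2.
have dpure t x y : d1 t (tau x y) = d2 t (tau x y).
  apply: (uniq (L d1 (tau x y)) (L d2 (tau x y))) => x' y' /=.
  by rewrite d1P d2P.
move=> t u; apply: (uniq (L d1 u) (L d2 u)) => x y /=.
rewrite (hermC d1) (hermC d2); congr (_ * _^* ); exact: dpure.
Qed.

(* Main.v *)
Require Import Defs.
From HB Require Import structures.
From mathcomp Require Import all_boot all_order all_algebra.
From mathcomp Require Import complex.
From mathcomp Require Import boolp reals.

(** Declare the basis vectors [e n] orthogonal, of lengths [a n > 0] to be chosen.
The pure tensors [tau (e m) (e n)] are then orthogonal of lengths [a m * a n] in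
the induced inner product, so a vector [t] with coordinates [t_mn] satisfies
[a m * a n * `|t_mn| <= sqrtC (ipT t t)] for each [m], [n], and
[`|Phi t| <= \sum_(m, n) `|Phi (tau (e m) (e n))| * `|t_mn|
          <= (\sum_(m, n) `|Phi (tau (e m) (e n))| / (a m * a n)) * sqrtC (ipT t t)].
It remains to make this last double series converge.  Any nonnegative doubly
indexed family [g] is majorized by a product, [g m n <= A m * A n] with
[1 <= A] ([product_majorant]): take for [A n] one plus the sum of the
[g i j] with [i, j <= n].  With [a n = 2 ^ n * A n] the series is bounded by
[\sum_(m, n) 2 ^- m * 2 ^- n = 4].

The rest makes the two orthogonal systems rigorous.  Both inner products are
instances of one construction ([weighted_dot]): given coordinate functionals
[k i], finitely many of which are nonzero at each vector, and weights [w i > 0],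
the form is [\sum_i w i * k i x * (k i y)^*].  On [H] the functionals come from
the Hamel basis ([hamel_coordinates]); on [T] they are the products of two
coordinates, lifted by the universal property ([tensor_functional]).  That every
element of [T] has finitely many coordinates and is determined by them holds
because these elements form a submodule containing the pure tensors, and such a
submodule is all of [T] ([tensor_product_span]). *)

Import Order.TTheory GRing.Theory Num.Theory.
Local Open Scope ring_scope.

Set Implicit Arguments.
Unset Strict Implicit.
Unset Printing Implicit Defensive.

(** * Finitely supported coordinates *)

Lemma eq_big_support (V : nmodType) (I : eqType) (F : I -> V) (r s : seq I) :
  uniq r -> uniq s ->
  (forall i, i \notin r -> F i = 0) -> (forall i, i \notin s -> F i = 0) ->
  \sum_(i <- r) F i = \sum_(i <- s) F i.
Proof.
move=> ur us Fr Fs.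
have restrict (p q : seq I) : (forall i, i \notin q -> F i = 0) ->
    \sum_(i <- p) F i = \sum_(i <- [seq j <- p | j \in q]) F i.
  by move=> Fq; rewrite big_filter (bigID (mem q)) /= [X in _ + X]big1 ?addr0 //.
rewrite (restrict r s) // (restrict s r) //.
apply/perm_big/uniq_perm; rewrite ?filter_uniq // => i.
by rewrite !mem_filter andbC.
Qed.

Section Coordinates.
Context {K : fieldType} {V : lmodType K} {I : eqType}.
Implicit Types (k : I -> {linear V -> K^o}) (b : I -> V).

(** The list need not be the exact support: supersets are allowed, so that several
vectors can share one list. *)
Definition supports k (v : V) (s : seq I) : Prop :=
  uniq s /\ forall i, i \notin s -> k i v = 0.

Definition expands b k (v : V) : Prop :=
  exists2 s, supports k v s & v = \sum_(i <- s) k i v *: b i.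

(** An expansion does not depend on the list carrying it, because the terms outside
any such list vanish. *)
Lemma expands_on b k v s : expands b k v -> supports k v s ->
  v = \sum_(i <- s) k i v *: b i.
Proof.
case=> r [ur kr] vE [us ks]; rewrite {1}vE.
by apply: eq_big_support => // i /[dup] h; [move/kr|move/ks] => ->; rewrite scale0r.
Qed.

Lemma supports_undup_cat k v s r : (supports k v s \/ supports k v r) ->
  supports k v (undup (s ++ r)).
Proof.
move=> h; split=> [|i]; first exact: undup_uniq.
by rewrite mem_undup mem_cat negb_or => /andP[? ?]; case: h => -[_]; apply.
Qed.

Lemma supports_linear k a u v s : supports k u s -> supports k v s ->
  supports k (a *: u + v) s.
Proof.
move=> [us ku] [_ kv]; split=> // i si.
by rewrite linearP ku // kv // scaler0 addr0.
Qed.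

(** This closure lets the expansion of a general tensor be checked on pure tensors
only. *)
Lemma expands_submod b k : submod_closed [pred v | `[< expands b k v >]].
Proof.
split=> [|a u v].
  rewrite inE; apply/asboolP; exists [::]; last by rewrite big_nil.
  by split=> // i _; rewrite linear0.
rewrite !inE => /asboolP eu /asboolP ev; apply/asboolP.
have [[r ru _] [s sv _]] := (eu, ev).
have ru' : supports k u (undup (r ++ s)) by apply: supports_undup_cat; left.
have sv' : supports k v (undup (r ++ s)) by apply: supports_undup_cat; right.
exists (undup (r ++ s)); first exact: supports_linear.
rewrite {1}(expands_on eu ru') {1}(expands_on ev sv') scaler_sumr -big_split /=.
by apply: eq_bigr => i _; rewrite linearP scalerDl scalerA.
Qed.

End Coordinates.

(** The coefficients chosen for each vector are extended by zero, so that any two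
vectors can be compared on a common initial segment; freeness of [e] there makes
the chosen coefficients linear in the vector. *)
Lemma hamel_coordinates (K : fieldType) (V : lmodType K) (e : nat -> V) :
  hamel_basis e ->
  exists k : nat -> {linear V -> K^o}, forall v, expands e k v.
Proof.
move=> [free span].
pose N v := projT1 (cid (span v)).
pose c v := projT1 (cid (projT2 (cid (span v)))).
have vE v : v = \sum_(i < N v) c v i *: e i := projT2 (cid (projT2 (cid (span v)))).
pose k v i := if (i < N v)%N then c v i else 0.
have kE v M : (N v <= M)%N -> v = \sum_(i < M) k v i *: e i.
  move=> NM; rewrite {1}[v]vE (big_ord_widen M (fun i => c v i *: e i)) //.
  rewrite big_mkcond; apply: eq_bigr => i _.
  by rewrite /k; case: ifP => //; rewrite scale0r.
have klin i : linear (fun v => k v i : K^o).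
  move=> a u v.
  (* Long enough to contain [i] and the three expansions compared. *)
  pose M := maxn i.+1 (maxn (N (a *: u + v)) (maxn (N u) (N v))).
  have iM : (i < M)%N by rewrite leq_maxl.
  apply/eqP; rewrite -subr_eq0; apply/eqP.
  pose d j := k (a *: u + v) j - (a * k u j + k v j).
  apply: (free M d _ (Ordinal iM)).
  rewrite (eq_bigr (fun j : 'I_M => k (a *: u + v) j *: e j -
     (a *: (k u j *: e j) + k v j *: e j))); last first.
    by move=> j _; rewrite scalerBl scalerDl scalerA.
  by rewrite sumrB big_split /= -scaler_sumr -!kE ?subrr // /M !leq_max leqnn ?orbT.
pose kk i : {linear V -> K^o} :=
  HB.pack (fun v => k v i : K^o) (GRing.isLinear.Build K V K^o *:%R _ (klin i)).
exists kk => v; exists (iota 0 (N v)).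
  split=> [|i]; first exact: iota_uniq.
  by rewrite mem_iota /= /k => /negbTE ->.
by rewrite {1}(kE v (N v)) // -(big_mkord xpredT (fun i => k v i *: e i)) /index_iota subn0.
Qed.

(** * Spanning and coordinates in a tensor product *)

Section Submodule.
Variables (K : fieldType) (T : lmodType K) (S : submodClosed T).
(** Indexed by the bundled [S] rather than by a bare predicate, so that the closure
proofs needed for the module structure are recovered from the type. *)
Record submodule := Submodule { submodule_val :> T; _ : submodule_val \in S }.
HB.instance Definition _ := [isSub for submodule_val].
HB.instance Definition _ := [Choice of submodule by <:].
HB.instance Definition _ := [SubChoice_isSubLmodule of submodule by <:].
End Submodule.

(** Corestrict [tau] to the submodule [S] and lift it to a map [T -> S].  Followed by
the inclusion [S -> T], it agrees with the identity on pure tensors, hence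
everywhere by uniqueness, so the identity of [T] takes its values in [S]. *)
Lemma tensor_product_span (K : fieldType) (U1 U2 T : lmodType K)
    (tau : {bilinear U1 -> U2 -> T}) (S : {pred T}) :
  is_tensor_product tau -> submod_closed S ->
  (forall x y, tau x y \in S) -> forall t, t \in S.
Proof.
move=> tauP Scl Stau.
pose S' : submodClosed T := HB.pack (S : T -> bool)
  (GRing.isSubmodClosed.Build K T S (GRing.submod_closed_semi Scl)).
pose f x y : submodule S' := @Submodule K T S' (tau x y) (Stau x y).
have fbil : bilinear_for (GRing.Scale.Law.clone _ _ *:%R _)
    (GRing.Scale.Law.clone _ _ *:%R _) f.
  by split=> [y|x] a u v; apply/val_inj; rewrite /= ?linearPl ?linearPr.
pose fb : {bilinear U1 -> U2 -> submodule S'} :=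
  HB.pack f (bilinear_isBilinear.Build K U1 U2 _ _ _ f fbil).
have [[g gE] _] := tauP _ fb.
have vlin : linear (fun t => \val (g t)) by move=> a u v; rewrite linearP.
pose vg : {linear T -> T} :=
  HB.pack (fun t => \val (g t)) (GRing.isLinear.Build K T T *:%R _ vlin).
have vgE : idfun =1 vg by apply: (tauP _ tau).2 => x y; rewrite /= gE.
by move=> t; rewrite -[t]/(idfun t) vgE; apply: valP.
Qed.

Lemma tensor_functional (K : fieldType) (U1 U2 T : lmodType K)
    (tau : {bilinear U1 -> U2 -> T})
    (f : {linear U1 -> K^o}) (g : {linear U2 -> K^o}) :
  is_tensor_product tau ->
  exists h : {linear T -> K^o}, forall x y, h (tau x y) = f x * g y.
Proof.
move=> tauP.
have fgbil : bilinear_for (GRing.Scale.Law.clone _ _ *:%R _)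
    (GRing.Scale.Law.clone _ _ *:%R _) (fun x y => f x * g y : K^o).
  split=> [y|x] a u v /=; rewrite linearP.
    by rewrite mulrDl -scalerAl.
  by rewrite mulrDr -scalerAr.
pose fg : {bilinear U1 -> U2 -> K^o} := HB.pack (fun x y => f x * g y : K^o)
  (bilinear_isBilinear.Build K U1 U2 _ _ _ _ fgbil).
exact: (tauP _ fg).1.
Qed.

Lemma supports_tensor (K : fieldType) (U1 U2 T : lmodType K) (I J : eqType)
    (tau : {bilinear U1 -> U2 -> T})
    (k : I -> {linear U1 -> K^o}) (l : J -> {linear U2 -> K^o})
    (h : I * J -> {linear T -> K^o}) x y r s :
  (forall p x y, h p (tau x y) = k p.1 x * l p.2 y) ->
  supports k x r -> supports l y s ->
  supports h (tau x y) [seq (i, j) | i <- r, j <- s].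
Proof.
move=> hE [ur kr] [us ls]; split=> [|[i j] ij].
  by apply: allpairs_uniq => // -[? ?] [? ?].
rewrite hE /=; have [ir|/kr -> //] := boolP (i \in r); last by rewrite mul0r.
have [js|/ls -> //] := boolP (j \in s); last by rewrite mulr0.
by case/negP: ij; apply: allpairs_f.
Qed.

(** Expanding both factors of a pure tensor expands it over the products of the two
lists; the other tensors follow since pure tensors span. *)
Lemma tensor_expands (K : fieldType) (U1 U2 T : lmodType K) (I J : eqType)
    (tau : {bilinear U1 -> U2 -> T}) (b : I -> U1) (c : J -> U2)
    (k : I -> {linear U1 -> K^o}) (l : J -> {linear U2 -> K^o})
    (h : I * J -> {linear T -> K^o}) :
  is_tensor_product tau ->
  (forall p x y, h p (tau x y) = k p.1 x * l p.2 y) ->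
  (forall x, expands b k x) -> (forall y, expands c l y) ->
  forall t, expands (fun p => tau (b p.1) (c p.2)) h t.
Proof.
move=> tauP hE bk cl t; apply/asboolP.
apply: (tensor_product_span tauP (expands_submod _ h)) => x y.
rewrite inE; apply/asboolP.
have [[r rx xE] [s sy yE]] := (bk x, cl y).
exists [seq (i, j) | i <- r, j <- s]; first exact: (supports_tensor hE rx sy).
rewrite big_allpairs {1}xE linear_sumlz; apply: eq_bigr => i _.
rewrite {1}yE linear_sumr; apply: eq_bigr => j _.
by rewrite linearZl_LR linearZr_LR scalerA hE.
Qed.

(** * Inner products making a basis orthogonal *)

Section WeightedDot.
Context {C : numClosedFieldType} {V : lmodType C} {I : eqType}.
Variables (b : I -> V) (k : I -> {linear V -> C^o}) (w : I -> C).
Hypotheses (wgt0 : forall i, 0 < w i) (bk : forall v, expands b k v).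

(** The sum is evaluated on an arbitrarily chosen list supporting its first argument.
Additivity and symmetry require summing two or more vectors over the same list, and
independence of the list provides this. *)
Lemma weighted_dot : exists ip : {dot V for Num.conj},
  forall x y s, supports k x s ->
    ip x y = \sum_(i <- s) w i * (k i x * (k i y)^* ).
Proof.
have hs v : exists s, supports k v s by have [s ? _] := bk v; exists s.
pose supp v := projT1 (cid (hs v)).
have suppP v : supports k v (supp v) := projT2 (cid (hs v)).
pose d x y := \sum_(i <- supp x) w i * (k i x * (k i y)^* ).
have dE x y s : supports k x s -> d x y = \sum_(i <- s) w i * (k i x * (k i y)^* ).
  move=> [us ks]; have [ux kx] := suppP x.
  by apply: eq_big_support => // i; [move/kx|move/ks] => ->; rewrite mul0r mulr0.
have dherm x y : d x y = (-1) ^+ false * (d y x)^*.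
  pose s := undup (supp x ++ supp y).
  rewrite expr0 mul1r (dE x y s); last by apply: supports_undup_cat; left.
  rewrite (dE y x s); last by apply: supports_undup_cat; right.
  rewrite rmorph_sum; apply: eq_bigr => i _ /=.
  by rewrite !rmorphM /= conjCK (geC0_conj (ltW (wgt0 i))) [_ * k i x]mulrC.
have dlin y : linear_for *%R (fun x => d x y).
  move=> a u v; pose s := undup (supp u ++ supp v).
  have su : supports k u s by apply: supports_undup_cat; left.
  have sv : supports k v s by apply: supports_undup_cat; right.
  rewrite (dE _ _ _ (supports_linear a su sv)) (dE u y s) // (dE v y s) //.
  rewrite mulr_sumr -big_split /=; apply: eq_bigr => i _.
  by rewrite linearP mulrDl mulrDr; congr (_ + _); rewrite -scalerAl mulrCA.
have dlinr x : linear_for (Num.conj \; *%R) (d x).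
  move=> a u v; rewrite dherm dlin expr0 mul1r rmorphD rmorphM /=.
  by rewrite [d x u]dherm [d x v]dherm expr0 !mul1r.
have dpos v : v != 0 -> 0 < d v v.
  move=> v0; rewrite lt_def.
  have sqE i : w i * (k i v * (k i v)^*) = w i * `|k i v| ^+ 2 by rewrite normCK.
  have ge0 i : 0 <= w i * (k i v * (k i v)^*).
    by rewrite sqE mulr_ge0 ?exprn_ge0 // ltW.
  rewrite sumr_ge0 ?andbT //; apply: contra v0.
  rewrite psumr_eq0 // => /allP kv0; rewrite (expands_on (bk v) (suppP v)).
  rewrite big_seq big1 // => i /kv0; rewrite sqE mulf_eq0 gt_eqF //=.
  by rewrite expf_eq0 normr_eq0 /= => /eqP ->; rewrite scale0r.
pose ip : {dot V for Num.conj} := HB.pack d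
  (isBilinear.Build C V V C *%R (Num.conj \; *%R) d
    (fun y => zmod_morphism_linear (dlin y)) (fun x => zmod_morphism_linear (dlinr x))
    (fun y => scalable_linear (dlin y)) (fun x => scalable_linear (dlinr x)))
  (isHermitianSesquilinear.Build C V false Num.conj d dherm)
  (isDotProduct.Build C V d dpos).
by exists ip.
Qed.
End WeightedDot.

(** Each coordinate of [v], scaled by the length [a i] of its basis vector, is at
most the norm of [v]; this turns the l1 bound on the values [phi (b i) / a i]
into a bound for [phi]. *)
Lemma weighted_dot_bounded (C : numClosedFieldType) (V : lmodType C) (I : eqType)
    (b : I -> V) (k : I -> {linear V -> C^o}) (a : I -> C)
    (ip : {dot V for Num.conj}) (phi : {scalar V}) (M : C) :
  (forall i, 0 < a i) -> (forall v, expands b k v) ->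
  (forall x y s, supports k x s ->
    ip x y = \sum_(i <- s) a i ^+ 2 * (k i x * (k i y)^* )) ->
  (forall s, uniq s -> \sum_(i <- s) `|phi (b i)| / a i <= M) ->
  forall v, `|phi v| <= M * sqrtC (ip v v).
Proof.
move=> agt0 bk ipE phiM v; have [s sv vE] := bk v; have [us _] := sv.
have term_ge0 j : 0 <= a j ^+ 2 * (k j v * (k j v)^*).
  by rewrite -normCK -exprMn exprn_ge0 // mulr_ge0 // ltW.
have ip_ge0 : 0 <= ip v v by rewrite (ipE _ _ s) // sumr_ge0.
have coef_le i : i \in s -> a i * `|k i v| <= sqrtC (ip v v).
  move=> si; have aknn : 0 <= a i * `|k i v| by rewrite mulr_ge0 // ltW.
  rewrite -(sqrCK aknn) ler_sqrtC ?nnegrE ?exprn_ge0 // (ipE _ _ s) //.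
  by rewrite (big_rem i) //= -normCK -exprMn lerDl sumr_ge0.
rewrite {1}vE linear_sum; apply: le_trans (ler_norm_sum _ _ _) _.
apply: le_trans (ler_wpM2r _ (phiM s us)); last by rewrite sqrtC_ge0.
rewrite mulr_suml big_seq [leRHS]big_seq; apply: ler_sum => i si.
rewrite linearZ normrM -mulrA mulrC ler_wpM2l //.
by rewrite ler_pdivlMl // coef_le.
Qed.

(** * Choice of the weights *)

(** With [A n] above the sum of the [g i j] for [i, j <= n], the larger of [m] and [n]
already gives [g m n <= A (maxn m n)], and the other factor only helps since it
is at least 1. *)
Lemma product_majorant (C : numClosedFieldType) (g : nat -> nat -> C) :
  (forall m n, 0 <= g m n) ->
  exists2 A : nat -> C, forall n, 1 <= A n & forall m n, g m n <= A m * A n.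
Proof.
move=> g0; pose A n := 1 + \sum_(i < n.+1) \sum_(j < n.+1) g i j.
have A1 n : 1 <= A n by rewrite lerDl !sumr_ge0 // => i _; rewrite sumr_ge0.
exists A => // m n.
have term_le p (f : 'I_p -> C) i : (forall j, 0 <= f j) -> f i <= \sum_j f j.
  by move=> f0; rewrite (bigD1 i) //= lerDl sumr_ge0.
have gA N : (m <= N)%N -> (n <= N)%N -> g m n <= A N.
  move=> mN nN.
  apply: le_trans (term_le _ (fun j : 'I_N.+1 => g m j) (Ordinal (nN : n < N.+1)%N) _) _ => //.
  apply: (@le_trans _ _ (\sum_(i < N.+1) \sum_(j < N.+1) g i j)).
    apply: (term_le _ (fun i : 'I_N.+1 => \sum_(j < N.+1) g i j) (Ordinal (mN : m < N.+1)%N)) => i.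
    exact: sumr_ge0.
  by rewrite lerDr.
have A0 N : 0 <= A N by apply: le_trans (A1 N).
have [/gA|/ltnW/gA] := leqP m n => /(_ (leqnn _)) h; apply: le_trans h _.
  by rewrite ler_peMl.
by rewrite ler_peMr.
Qed.

(** A list without repetition is contained in a square [P] of pairs, over which the sum
is the square of a partial sum of the geometric series of ratio 1/2. *)
Lemma geometric_double_sum (C : numClosedFieldType) (s : seq (nat * nat)) :
  uniq s -> \sum_(p <- s) (2%:R ^+ p.1)^-1 * (2%:R ^+ p.2)^-1 <= 4%:R :> C.
Proof.
move=> us.
pose h n : C := (2%:R ^+ n)^-1.
have h0 n : 0 <= h n by rewrite invr_ge0 exprn_ge0.
have hS n : h n = 2%:R * h n.+1.
  by rewrite /h exprS invfM mulrA divff ?mul1r // pnatr_eq0.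
have geo M : \sum_(i <- iota 0 M) h i = 2%:R - 2%:R * h M.
  elim: M => [|M IH]; first by rewrite big_nil /h expr0 invr1 mulr1 subrr.
  rewrite -addn1 iotaD big_cat IH /= big_seq1 add0n addn1 -hS.
  by rewrite mulr_natl mulr2n opprD addrA subrK.
pose N := (\max_(p <- s) maxn p.1 p.2).+1.
pose P := [seq (m, n) | m <- iota 0 N, n <- iota 0 N].
have sN p : p \in s -> p \in P.
  move=> ps; apply/allpairsP; exists p; rewrite !mem_iota /= !add0n !ltnS.
  have pN : (maxn p.1 p.2 <= \max_(q <- s) maxn q.1 q.2)%N.
    exact: leq_bigmax_seq.
  by split; [move: pN; rewrite geq_max => /andP[]..|case: p {ps pN}].
have pairs_sub : perm_eq s [seq p <- P | p \in s].
  apply: uniq_perm => // [|p].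
    by apply/filter_uniq/allpairs_uniq; rewrite ?iota_uniq // => -[? ?] [? ?].
  by rewrite mem_filter andb_idr //; apply: sN.
rewrite (perm_big _ pairs_sub) big_filter.
apply: (@le_trans _ _ (\sum_(p <- P) h p.1 * h p.2)).
  by rewrite [leRHS](bigID (mem s)) /= lerDl sumr_ge0 // => p _; apply: mulr_ge0.
rewrite big_allpairs /=.
have -> : \sum_(m <- iota 0 N) \sum_(n <- iota 0 N) h m * h n =
    (\sum_(m <- iota 0 N) h m) ^+ 2.
  by rewrite expr2 mulr_suml; apply: eq_bigr => m _; rewrite mulr_sumr.
have geo2 : \sum_(m <- iota 0 N) h m <= 2%:R.
  by rewrite geo gerBl mulr_ge0.
by rewrite (_ : 4%:R = 2%:R ^+ 2) ?lerXn2r ?nnegrE ?sumr_ge0 // -natrX.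
Qed.

Unset Implicit Arguments.

(** * Boundedness of functionals on the tensor square *)

Theorem theorem8p14 (R : realType) (H : lmodType R[i]) (e : nat -> H)
    (he : hamel_basis e)
    (T : lmodType R[i]) (tau : {bilinear H -> H -> T})
    (hT : is_tensor_product tau)
    (Phi : {scalar T}) :
  exists (ip : {dot H for Num.conj}) (ipT : {dot T for Num.conj}),
    is_tensor_dot tau ip ipT /\ bounded_functional ipT Phi.
Proof.
have [k ek] := hamel_coordinates he.
have [h hE] := choice (fun p : nat * nat => tensor_functional (k p.1) (k p.2) hT).
have eTh := tensor_expands hT hE ek ek.
have [A A1 PhiA] := product_majorant (fun m n => normr_ge0 (Phi (tau (e m) (e n)))).
have A0 n : 0 < A n by apply: lt_le_trans (A1 n).
(* The lengths of the basis vectors; the powers of 2 make the series converge. *)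
pose a n : R[i] := 2%:R ^+ n * A n.
have a0 n : 0 < a n by rewrite mulr_gt0 ?exprn_gt0 ?ltr0n.
have a20 n : 0 < a n ^+ 2 by rewrite exprn_gt0.
pose aT p := a p.1 * a p.2.
have aT0 p : 0 < aT p by rewrite mulr_gt0.
have aT20 p : 0 < aT p ^+ 2 by rewrite exprn_gt0.
have [ip ipE] := weighted_dot a20 ek.
have [ipT ipTE] := weighted_dot aT20 eTh.
exists ip, ipT; split.
  move=> x y x' y'; have [[r rx _] [s sy _]] := (ek x, ek y).
  rewrite (ipTE _ _ _ (supports_tensor hE rx sy)) (ipE _ _ _ rx) (ipE _ _ _ sy).
  rewrite big_allpairs mulr_suml; apply: eq_bigr => i _.
  rewrite mulr_sumr; apply: eq_bigr => j _.
  by rewrite !hE /= rmorphM exprMn [RHS]mulrACA; congr (_ * _); rewrite mulrACA.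
exists 4%:R => t; rewrite rmorph_nat.
apply: (weighted_dot_bounded aT0 eTh ipTE) => s us.
apply: le_trans _ (geometric_double_sum R[i] us); apply: ler_sum => -[m n] _ /=.
by rewrite ler_pdivrMr // /aT /a /= [leRHS]mulrACA !mulKf ?expf_neq0 ?pnatr_eq0 //.
Qed.
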